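(* Let $(X_t)_{t\ge0}$ be a time-homogeneous continuous-time Markov process with countable state space $S$ (transition rates not assumed symmetric), let $i\in S$, and suppose $p_t(i,i)\sim ct^{-\alpha}$ as $t\to\infty$ for some $c,\alpha>0$. Let $L_t=\int_0^t\mathbf 1_{\{X_s=i\}}\,ds$ for the process started in $i$, and $f(t)=p_t(i,i)$. Then for every $\kappa>0$, $$r(\kappa):=\lim_{t\to\infty}\frac1t\log\mathbb{E}[e^{\kappa L_t}]=\hat f^{-1}\Big(\frac1\kappa\Big).$$
   Context: $p_t(i,j)=\mathbb{P}[X_t=j\mid X_0=i]$; the process is a (conservative) continuous-time Markov chain with right-continuous paths. $\hat f(\lambda)=\int_0^\infty e^{-\lambda t}f(t)\,dt$, $\lambda>0$, is the Laplace transform, a strictly decreasing function; its inverse is understood as $\hat f^{-1}(y)=\inf\{\lambda>0\mid\hat f(\lambda)<y\}$ for $y>0$, so that $\hat f^{-1}(y)=0$ if and only if $y\ge\int_0^\infty f(t)\,dt$. $h_1\sim h_2$ means $\lim h_1/h_2=1$. *)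

(* Defs.v *)
From HB Require Import structures.
From mathcomp Require Import all_boot all_order all_algebra.
From mathcomp Require Import all_classical all_reals all_analysis.
Set Implicit Arguments.
Unset Strict Implicit.
Unset Printing Implicit Defensive.
Import Order.TTheory GRing.Theory Num.Theory numFieldNormedType.Exports.
Local Open Scope classical_set_scope.
Local Open Scope ring_scope.

Section MarkovChain.
Context {d : measure_display} {Omega : measurableType d} {R : realType}
  {S : countType}.

(* [P x] is the law of the process started in [x]; only the times [0 <= t]
   are meaningful. *)
Definition transition_prob (P : S -> probability Omega R) (X : R -> Omega -> S)
    (t : R) (x y : S) : R :=
  fine (P x [set w | X t w = y]).

(* Every [X t w] is a state, so no mass is lost: the transition probabilities
   out of a state sum to 1.  [S] carries the discrete topology, for which
   right-continuity means being locally constant to the right. *)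
Record markov_chain (P : S -> probability Omega R) (X : R -> Omega -> S)
    : Prop := MarkovChain {
  measurable_state : forall t y, 0 <= t -> measurable [set w | X t w = y];
  initial_state : forall x, P x [set w | X 0 w = x] = 1%E;
  right_continuous_paths : forall w t, 0 <= t ->
    \forall s \near t^'+, X s w = X t w;
  markov_property : forall (x : S) (n : nat) (t : nat -> R) (y : nat -> S),
    0 <= t 0%N -> (forall k, (k <= n)%N -> t k <= t k.+1) ->
    P x [set w | forall k, (k <= n.+1)%N -> X (t k) w = y k] =
    (P x [set w | forall k, (k <= n)%N -> X (t k) w = y k] *
     (transition_prob P X (t n.+1 - t n) (y n) (y n.+1))%:E)%E
}.

Definition local_time (X : R -> Omega -> S) (i : S) (t : R) (w : Omega) : R :=
  \int[lebesgue_measure]_(s in `[0, t]) \1_[set u | X u w = i] s.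

End MarkovChain.

Section Laplace.
Context {R : realType}.

Definition laplace (f : R -> R) (l : R) : \bar R :=
  (\int[lebesgue_measure]_(t in `[0%R, +oo[) (expR (- l * t) * f t)%:E)%E.

Definition laplace_inv (f : R -> R) (y : R) : \bar R :=
  ereal_inf [set l%:E | l in [set l : R | 0 < l /\ (laplace f l < y%:E)%E]].

Definition asymp_equiv (h1 h2 : R -> R) : Prop :=
  h1 t / h2 t @[t --> +oo] --> (1 : R).

End Laplace.

(* Main.v *)
(** Nothing but the values of the chain at [i] enters: with mesh [h = t/n] and
    [c = e^(kappa h) - 1], the exponential moment of the Riemann sum of the
    occupation time is [U_n = E prod_(1 <= j <= n) (1 + c 1_(X_(jh) = i))], and
    the Markov property at [i] gives the discrete renewal equation
    [U_M = 1 + c sum_(1 <= j <= M) f(jh) U_(M-j)]. If [laplace f l < 1/kappa],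
    induction on [M] yields [U_M <= C e^(l M h)]; if [laplace f l > 1/kappa], the
    inequality survives truncating the integral at some [T], and induction yields
    [U_M >= e^(-l T) e^(l M h)]. The constants do not depend on [n], and
    right-continuity of paths lets [n] tend to infinity. *)
Require Import Defs.
From HB Require Import structures.
From mathcomp Require Import all_boot all_order all_algebra.
From mathcomp Require Import all_classical all_reals all_analysis.
From mathcomp Require Import measurable_realfun ring lra.
Import Order.TTheory GRing.Theory Num.Theory numFieldNormedType.Exports.
Local Open Scope classical_set_scope.
Local Open Scope ring_scope.

(** * The discrete renewal equation and geometric bounds for its solution *)

Section DiscreteRenewal.
Context {R : realType} (f : nat -> R) (c : R).

(* With [f j = p_(jh)(i,i)], [renewal k M] is the expectation of the product of
   [1 + c 1_(X_(jh) = i)] over [k < j <= k + M] for the chain started in [i]. *)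
Fixpoint renewal (k M : nat) : R :=
  if M is M'.+1 then renewal k.+1 M' + c * f k.+1 * renewal 0 M' else 1.

(** Multiply out the product and sort by the first factor that contributes its indicator term: the
    leading [1] is the case of none, and in term [j] the chain restarts from [i] at grid point
    [(k + j).+1], with [M - j.+1] points left. *)
Lemma renewal_sum (k M : nat) :
  renewal k M = 1 + c * \sum_(j < M) f (k + j).+1 * renewal 0 (M - j.+1).
Proof.
elim: M k => [|M IH] k; first by rewrite big_ord0 mulr0 addr0.
rewrite /= IH big_ord_recl /= addn0 subn1 /= mulrDr mulrA addrAC addrA.
congr (_ + _ + _); congr (_ * _); apply: eq_bigr => j _.
by rewrite /bump /= addnS addSn add1n subSS.
Qed.

Hypothesis c_ge0 : 0 <= c.
Hypothesis f_ge0 : forall j, 0 <= f j.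

Lemma renewal_ge1 (k M : nat) : 1 <= renewal k M.
Proof.
elim: M k => [|M IH] k //=; rewrite (le_trans (IH k.+1)) // lerDl.
by rewrite !mulr_ge0 // (le_trans ler01 (IH _)).
Qed.

(** Strong induction on the renewal equation: dividing by [q ^+ M] gives the sum total weight at
    most [theta], the constant [1] is at most [q ^+ M], and [1 + theta / (1 - theta) = 1 / (1 -
    theta)] closes the induction. *)
Lemma renewal_le (q theta : R) (N M : nat) : 1 <= q -> theta < 1 ->
  c * (\sum_(j < N) f j.+1 * q ^- j.+1) <= theta -> (M <= N)%N ->
  renewal 0 M <= q ^+ M / (1 - theta).
Proof.
move=> q1 th1 hth; have q0 : 0 < q by exact: lt_le_trans ltr01 q1.
have th0 : 0 < 1 - theta by rewrite subr_gt0.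
elim/ltn_ind: M => M IH leMN.
have qM : 1 <= q ^+ M by rewrite exprn_ege1.
rewrite renewal_sum.
apply: (@le_trans _ _ (1 + q ^+ M / (1 - theta) *
    (c * \sum_(j < M) f j.+1 * q ^- j.+1))).
  rewrite lerD2l mulrCA ler_wpM2l // mulr_sumr ler_sum // => j _.
  have qE : q ^+ M = q ^+ (M - j.+1) * q ^+ j.+1 by rewrite -exprD subnK.
  rewrite add0n [X in _ <= X]mulrCA ler_wpM2l //.
  apply: le_trans (IH _ _ _) _.
  - by rewrite -subn_gt0 subKn.
  - exact: leq_trans (leq_subr _ _) leMN.
  - by rewrite qE mulrAC mulfK // expf_neq0 // gt_eqF.
have : c * (\sum_(j < M) f j.+1 * q ^- j.+1) <= theta.
  apply: le_trans hth; rewrite ler_wpM2l //.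
  rewrite (big_ord_widen N (fun j => f j.+1 * q ^- j.+1) leMN) big_mkcond /=.
  apply: ler_sum => j _; case: ifP => // _.
  by rewrite mulr_ge0 // invr_ge0 exprn_ge0 // ltW.
move=> /(ler_wpM2l (ltW (divr_gt0 (lt_le_trans ltr01 qM) th0))) h.
apply: (@le_trans _ _ (q ^+ M + q ^+ M / (1 - theta) * theta)).
  exact: lerD.
by rewrite le_eqVlt; apply/orP; left; apply/eqP; field; rewrite gt_eqF.
Qed.

(** Up to [K] the trivial bound [renewal_ge1] suffices, by the choice of [m]. Beyond [K], the
    constant [1] and the terms of index at least [K] are dropped, and the remaining weights still
    sum to at least [1]. *)
Lemma renewal_ge (q m : R) (K M : nat) : 1 <= q -> 0 <= m ->
  m * q ^+ K <= 1 -> 1 <= c * (\sum_(j < K) f j.+1 * q ^- j.+1) ->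
  m * q ^+ M <= renewal 0 M.
Proof.
move=> q1 m0 mK hK; have q0 : 0 < q by exact: lt_le_trans ltr01 q1.
elim/ltn_ind: M => M IH.
have [leMK|ltKM] := leqP M K.
  apply: le_trans (renewal_ge1 _ _); apply: le_trans mK.
  by rewrite ler_wpM2l // ler_weXn2l.
rewrite renewal_sum.
apply: (@le_trans _ _ (m * q ^+ M * (c * \sum_(j < K) f j.+1 * q ^- j.+1))).
  by rewrite ler_peMr // mulr_ge0 // exprn_ge0 // ltW.
apply: ler_wpDl => //; rewrite mulrCA ler_wpM2l //.
rewrite (big_ord_widen M (fun j => f j.+1 * q ^- j.+1) (ltnW ltKM)) big_mkcond /=.
rewrite mulr_sumr; apply: ler_sum => j _.
have qE : q ^+ M = q ^+ (M - j.+1) * q ^+ j.+1 by rewrite -exprD subnK.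
have H : m * q ^+ M * (f j.+1 * q ^- j.+1) <= f (0 + j).+1 * renewal 0 (M - j.+1).
  rewrite add0n mulrCA ler_wpM2l //; apply: le_trans (IH _ _).
    by rewrite qE mulrA mulfK // expf_neq0 // gt_eqF.
  by rewrite -subn_gt0 subKn.
case: ifP => _ //; rewrite mulr0 mulr_ge0 //.
exact: le_trans ler01 (renewal_ge1 _ _).
Qed.

End DiscreteRenewal.

(** * Right-endpoint Riemann sums of bounded right-continuous functions *)

Section RightEndpointSums.
Context {R : realType} (t : R).
Hypothesis t_gt0 : 0 < t.
Local Notation mu := (@lebesgue_measure R).

Definition mesh (n : nat) : R := t / n.+1%:R.

Definition cell (n j : nat) : set R := `[mesh n *+ j, mesh n *+ j.+1[.

Definition right_step (g : R -> R) (n : nat) (s : R) : R :=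
  \sum_(j < n.+1) g (mesh n *+ j.+1) * \1_(cell n j) s.

Lemma mesh_gt0 (n : nat) : 0 < mesh n.
Proof. by rewrite divr_gt0. Qed.

Lemma mesh_total (n : nat) : mesh n *+ n.+1 = t.
Proof. by rewrite /mesh -[LHS]mulr_natr divfK // pnatr_eq0. Qed.

Lemma mesh_cvg0 : mesh n @[n --> \oo] --> 0.
Proof.
by rewrite -(mulr0 t); apply: cvgM; [exact: cvg_cst|exact: cvg_harmonic].
Qed.

(** The right endpoint of the cell containing [s]. It lies strictly beyond [s], even when [s] is a
    grid point, so right-continuity at [s] applies along these nodes. *)
Definition next_node (n : nat) (s : R) : R := mesh n *+ (Num.trunc (s / mesh n)).+1.

Lemma next_node_bounds (n : nat) (s : R) : 0 <= s ->
  s < next_node n s <= s + mesh n.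
Proof.
move=> s0; have h0 := mesh_gt0 n.
have /andP[lo hi] := trunc_itv (divr_ge0 s0 (ltW h0)).
rewrite /next_node -mulr_natl; apply/andP; split.
  by rewrite -ltr_pdivrMr.
by rewrite -natr1 mulrDl mul1r lerD2r -ler_pdivlMr.
Qed.

Lemma next_node_cvg (s : R) : 0 <= s -> next_node n s @[n --> \oo] --> s.
Proof.
move=> s0; apply: (@squeeze_cvgr _ _ _ _ (fun=> s) (fun n => s + mesh n)).
- by near=> n; have /andP[/ltW -> ->] := next_node_bounds n s s0.
- exact: cvg_cst.
- by rewrite -[X in _ --> X]addr0; apply: cvgD; [exact: cvg_cst|exact: mesh_cvg0].
Unshelve. all: by end_near. Qed.

Lemma measurable_cell (n j : nat) (D : set R) :
  measurable_fun D (\1_(cell n j) : R -> R).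
Proof. by apply: measurable_funTS; apply/measurable_indicP; exact: measurable_itv. Qed.

Lemma cellP (n j : nat) (s : R) : 0 <= s ->
  cell n j s <-> j = Num.trunc (s / mesh n).
Proof.
move=> s0; have h0 := mesh_gt0 n.
have -> : cell n j s = (j%:R <= s / mesh n < j.+1%:R).
  by rewrite ler_pdivlMr // ltr_pdivrMr // !mulr_natl.
split; first by move=> h; apply/esym/trunc_def.
by move=> ->; apply: trunc_itv; rewrite divr_ge0 // ltW.
Qed.

Lemma right_stepE (g : R -> R) (n : nat) (s : R) : 0 <= s < t ->
  right_step g n s = g (next_node n s).
Proof.
move=> /andP[s0 st]; set j0 := Num.trunc (s / mesh n).
have h0 := mesh_gt0 n.
have lt_j0 : (j0 < n.+1)%N.
  rewrite -(ltr_nat R); have /andP[lo _] := trunc_itv (divr_ge0 s0 (ltW h0)).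
  by apply: le_lt_trans lo _; rewrite ltr_pdivrMr // mulr_natl mesh_total.
rewrite /right_step (bigD1 (Ordinal lt_j0)) //= big1 ?addr0 => [|j neq].
  by rewrite indicE mem_set ?mulr1 //; exact/cellP.
rewrite indicE memNset ?mulr0 // => /(cellP _ _ s s0) jE.
by move/eqP: neq; apply; exact: val_inj.
Qed.

Lemma measurable_right_step (g : R -> R) (n : nat) (D : set R) :
  measurable_fun D (right_step g n).
Proof.
apply: measurable_sum => j; apply: measurable_funM => //.
exact: measurable_cell.
Qed.

Lemma integral_right_step (g : R -> R) (n : nat) :
  (forall s, 0 <= s -> 0 <= g s) ->
  (\int[mu]_(s in `[0%R, t[) (right_step g n s)%:E)%E
  = (mesh n * \sum_(j < n.+1) g (mesh n *+ j.+1))%:E.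
Proof.
move=> g0; have node_ge0 j : 0 <= g (mesh n *+ j).
  by rewrite g0 // mulrn_wge0 // ltW // mesh_gt0.
under eq_integral do rewrite /right_step -sumEFin.
rewrite ge0_integral_sum //; first last.
- by move=> j s _; rewrite lee_fin mulr_ge0.
- move=> j; apply/measurable_EFinP; apply: measurable_funM => //.
  exact: measurable_cell.
rewrite mulr_sumr -sumEFin; apply: eq_bigr => j _.
under eq_integral do rewrite EFinM.
rewrite ge0_integralZl_EFin //; last first.
  apply/measurable_EFinP; exact: measurable_cell.
rewrite integral_indic //; last exact: measurable_itv.
rewrite setIidl => [|s /=]; last first.
  rewrite /cell /= !in_itv /= => /andP[lo hi].
  rewrite (le_trans _ lo) ?mulrn_wge0 ?(ltW (mesh_gt0 n)) //=.
  apply: lt_le_trans hi _; rewrite -[leRHS](mesh_total n) ler_pMn2l ?mesh_gt0 //.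
rewrite mulrC EFinM; congr (_ * _)%E.
apply: etrans (lebesgue_measure_itv _) _; rewrite /= lte_fin ltr_pMn2l ?mesh_gt0 // ltnSn.
by rewrite -EFinB -mulrnBr // subSnn mulr1n.
Qed.

Section RightContinuous.
Context (g : R -> R) (M : R).
Hypothesis g_bounds : forall s, 0 <= s -> 0 <= g s <= M.
Hypothesis g_rcont : forall s, 0 <= s < t -> g r @[r --> s^'+] --> g s.

Let step_cvg (s : R) : `[0%R, t[%classic s -> right_step g n s @[n --> \oo] --> g s.
Proof.
rewrite /= in_itv /= => st; have /andP[s0 _] := st.
under eq_cvg do rewrite right_stepE //.
move/cvg_at_rightP : (g_rcont s st); apply; split => [n|].
  by have /andP[] := next_node_bounds n s s0.
exact: next_node_cvg.
Qed.

(** The right step functions are measurable and converge pointwise to [g]. *)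
Lemma measurable_right_continuous : measurable_fun `[0%R, t[ g.
Proof.
apply: (@measurable_fun_cvg _ _ _ _ (right_step g)) => //.
by move=> n; exact: measurable_right_step.
Qed.

(** Dominated convergence for the right step functions, with the constant [M] as dominating
    function. The interval is half-open because [t] itself lies in no cell. *)
Lemma integrable_right_sum_cvg :
  mu.-integrable `[0%R, t[ (EFin \o g) /\
  (mesh n * \sum_(j < n.+1) g (mesh n *+ j.+1))%:E @[n --> \oo] -->
  (\int[mu]_(s in `[0%R, t[) (g s)%:E)%E.
Proof.
have g0 s : 0 <= s -> 0 <= g s by move=> /g_bounds/andP[].
have [||||||gint _] := @dominated_convergence _ _ R mu `[0%R, t[%classic _
  (fun n s => (right_step g n s)%:E) (EFin \o g) (fun=> M%:E) _ _ _ _ _ => //.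
- by move=> n; apply/measurable_EFinP; exact: measurable_right_step.
- apply/measurable_EFinP; exact: measurable_right_continuous.
- apply: aeW => s st; apply: cvg_EFin; first exact: nearW.
  exact: step_cvg.
- apply/integrableP; split => //.
  rewrite integral_cst //= lebesgue_measure_itv /= lte_fin t_gt0 -EFinB -EFinM.
  exact: ltry.
- apply: aeW => s n; rewrite /= in_itv /= => st.
  have /andP[s0 _] := st; have /andP[/ltW /(le_trans s0) /g_bounds /andP[gs0 gsM] _] :=
    next_node_bounds n s s0.
  by rewrite right_stepE // lee_fin ger0_norm.
by under eq_fun do rewrite integral_right_step //; split.
Qed.

Lemma right_sum_cvg :
  mesh n * \sum_(j < n.+1) g (mesh n *+ j.+1) @[n --> \oo] -->
  \int[mu]_(s in `[0%R, t]) g s.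
Proof.
have [gint cvg] := integrable_right_sum_cvg.
(* The closed interval is the one in [local_time]; the added endpoint is a null set. *)
rewrite -Rintegral_itv_bndo_bndc //.
move: cvg; rewrite -(fineK (integrable_fin_num _ gint)) //.
by move=> /fine_cvgP[].
Qed.

End RightContinuous.
End RightEndpointSums.

(** * The Markov property at successive visits to [i] *)

Section PinnedChain.
Context {R : realType} {d : measure_display} {Omega : measurableType d}
  {S : countType}.
Context (P : S -> probability Omega R) (X : R -> Omega -> S).
Hypothesis HX : markov_chain P X.
Variable i : S.
Local Notation p := (fun t => transition_prob P X t i i).
Local Notation b := (fun t : R => \1_[set w | X t w = i] : Omega -> R).

(** The Markov property is available for events that prescribe the chain at finitely many ordered
    times. Here all prescribed values are [i] and [s] is the last time; the family is stable under
    adding a later visit, which the induction over grid points requires. *)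
Definition pinned (A : set Omega) (s : R) : Prop :=
  [/\ 0 <= s, measurable A & exists (n : nat) (t : nat -> R),
    [/\ 0 <= t 0%N, forall k, (k < n)%N -> t k <= t k.+1, t n = s &
        A = [set w | forall k, (k <= n)%N -> X (t k) w = i]]].

Lemma pinned0 : pinned [set w | X 0 w = i] 0.
Proof.
split => //; first exact: (measurable_state HX).
exists 0%N, (fun=> 0); split => //.
by apply/seteqP; split => [w Xw k _ //|w /(_ 0%N isT)].
Qed.

Lemma transition_prob_ge0 (t : R) : 0 <= p t.
Proof. by rewrite fine_ge0 // measure_ge0. Qed.

Lemma transition_prob_le1 (t : R) : 0 <= t -> p t <= 1.
Proof.
move=> t0; have mt := measurable_state HX i t0.
by rewrite /transition_prob -lee_fin fineK ?probability_le1 // fin_num_measure.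
Qed.

(** The Markov property at time [s], applied to the list of times with [s + u] appended. *)
Lemma pinnedI (A : set Omega) (s u : R) : pinned A s -> 0 <= u ->
  let B := A `&` [set w | X (s + u) w = i] in
  pinned B (s + u) /\ P i B = (P i A * (p u)%:E)%E.
Proof.
move=> [s0 mA [n [t [t0 t_nd tn AE]]]] u0 B.
have su0 : 0 <= s + u by rewrite addr_ge0.
pose t' k := if (k <= n)%N then t k else s + u.
have t'E k : (k <= n)%N -> t' k = t k by rewrite /t' => ->.
have t'n : t' n.+1 = s + u by rewrite /t' ltnn.
have t'_nd k : (k <= n)%N -> t' k <= t' k.+1.
  rewrite leq_eqVlt => /predU1P[->|ltkn]; first by rewrite t'n t'E // tn lerDl.
  by rewrite !t'E // ?t_nd // ltnW.
have AE' : A = [set w | forall k, (k <= n)%N -> X (t' k) w = i].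
  by rewrite AE; apply/seteqP; split => w H k le_kn; have := H k le_kn; rewrite t'E.
have BE : B = [set w | forall k, (k <= n.+1)%N -> X (t' k) w = i].
  rewrite /B AE'; apply/seteqP; split => w /=.
    by move=> [H Hu] k; rewrite leq_eqVlt => /predU1P[->|]; [rewrite t'n|exact: H].
  by move=> H; split => [k le_kn|]; [exact/H/leqW|rewrite -t'n; exact: H].
split; last first.
  rewrite BE (markov_property HX i (n := n) (t := t') (fun=> i)) //.
  by rewrite -AE' t'n t'E // tn addrAC subrr add0r.
split => //; first by apply: measurableI => //; exact: (measurable_state HX).
by exists n.+1, t'; split => //; rewrite t'E.
Qed.

Lemma measurable_at_state (t : R) : 0 <= t -> measurable_fun setT (b t).
Proof. by move=> t0; apply/measurable_indicP; exact: (measurable_state HX). Qed.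

(** Here [s] is the last pinned time and [k] counts the grid points after [s] that have already been
    passed over, matching the first argument of [renewal]. *)
Definition visit_prod (c h s : R) (k M : nat) (w : Omega) : R :=
  \prod_(j < M) (1 + c * b (s + h *+ (k + j).+1) w).

Lemma visit_prod_ge0 (c h s : R) (k M : nat) (w : Omega) :
  0 <= c -> 0 <= visit_prod c h s k M w.
Proof. by move=> c0; apply: prodr_ge0 => j _; rewrite addr_ge0 // mulr_ge0. Qed.

Lemma measurable_visit_prod (c h s : R) (k M : nat) : 0 <= h -> 0 <= s ->
  measurable_fun setT (visit_prod c h s k M).
Proof.
move=> h0 s0; apply: measurable_prod => j _.
apply: measurable_funD => //; apply: measurable_funM => //.
by apply: measurable_at_state; rewrite addr_ge0 // mulrn_wge0.
Qed.

(* Expanding the first factor [1 + c b] splits the product into a product whose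
   first grid point is skipped and one restarted from a new pinned time. *)
Lemma integral_visit_prod (c h : R) (M k : nat) (A : set Omega) (s : R) :
  0 <= c -> 0 <= h -> pinned A s ->
  (\int[P i]_w (\1_A w * visit_prod c h s k M w)%:E =
   P i A * (renewal (fun j => p (h *+ j)) c k M)%:E)%E.
Proof.
move=> c0 h0; elim: M k A s => [|M IH] k A s pA; have [s0 mA _] := pA.
  under eq_integral do rewrite /visit_prod big_ord0 mulr1.
  by rewrite integral_indic // setIT mule1.
pose u := h *+ k.+1; have u0 : 0 <= u by rewrite mulrn_wge0.
pose B := A `&` [set w | X (s + u) w = i].
have [pB PB] := pinnedI A s u pA u0; have [su0 mB _] := pB.
have prodE w : \1_A w * visit_prod c h s k M.+1 w =
    \1_A w * visit_prod c h s k.+1 M w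
    + c * (\1_B w * visit_prod c h (s + u) 0 M w).
  rewrite {1}/visit_prod big_ord_recl /= addn0 -/u /B indicI /=.
  have -> : \prod_(j < M) (1 + c * b (s + h *+ (k + bump 0 j).+1) w) =
      visit_prod c h s k.+1 M w.
    by apply: eq_bigr => j _; rewrite addnS.
  have -> : visit_prod c h (s + u) 0 M w = visit_prod c h s k.+1 M w.
    apply: eq_bigr => j _.
    by rewrite -addrA /u -mulrnDr add0n addSn addSn addnS.
  ring.
have ge0 D h' s' k' : forall w, setT w -> (0 <= (\1_D w * visit_prod c h' s' k' M w)%:E)%E.
  by move=> w _; rewrite lee_fin mulr_ge0 // visit_prod_ge0.
have meas D s' k' : measurable D -> 0 <= s' ->
    measurable_fun setT (fun w => (\1_D w * visit_prod c h s' k' M w)%:E).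
  move=> mD s'0; apply/measurable_EFinP; apply: measurable_funM.
    exact/measurable_indicP.
  exact: measurable_visit_prod.
under eq_integral do rewrite prodE EFinD [X in (_ + X)%E]EFinM.
rewrite ge0_integralD //; first last.
- by apply: measurable_funeM; exact: meas.
- by move=> w _; rewrite mule_ge0 // ge0.
- exact: meas.
- exact: ge0.
rewrite ge0_integralZl_EFin //; [|exact: ge0|exact: meas].
rewrite IH // IH // PB /=.
have alg (a x y z v : R) :
    (a%:E * x%:E + v%:E * (a%:E * z%:E * y%:E) = a%:E * (x + v * z * y)%:E)%E.
  by rewrite -!EFinM -EFinD; congr EFin; ring.
rewrite -(fineK (fin_num_measure (P i) _ mA)).
exact: alg.
Qed.

End PinnedChain.

(** * The exponential moment of the occupation time as a limit of renewal sequences *)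

Section ExponentialMoment.
Context {R : realType} {d : measure_display} {Omega : measurableType d}
  {S : countType}.
Context (P : S -> probability Omega R) (X : R -> Omega -> S).
Hypothesis HX : markov_chain P X.
Variable i : S.
Local Notation p := (fun t => transition_prob P X t i i).
Local Notation b := (fun t : R => \1_[set w | X t w = i] : Omega -> R).

(** An indicator [b] takes only the values [0] and [1], hence
    [1 + (expR x - 1) * b = expR (x * b)]. *)
Lemma visit_prod_expR (kappa h : R) (N : nat) (w : Omega) :
  visit_prod X i (expR (kappa * h) - 1) h 0 0 N w =
  expR (kappa * (h * \sum_(j < N) b (h *+ j.+1) w)).
Proof.
rewrite !mulr_sumr expR_sum; apply: eq_bigr => j _.
rewrite add0r add0n indicE; case: (_ \in _).
  by rewrite !mulr1 addrC subrK.
by rewrite !mulr0 expR0 addr0.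
Qed.

Lemma indic_path_rcont (w : Omega) (s : R) : 0 <= s ->
  b r w @[r --> s^'+] --> b s w.
Proof.
move=> s0; apply: cvg_near_cst; near=> r.
have Xrs : X r w = X s w by near: r; exact: (right_continuous_paths HX).
by rewrite !indicE; congr (_%:R); congr (nat_of_bool _); apply/idP/idP => /set_mem /= H;
  apply/mem_set => /=; rewrite -H.
Unshelve. all: by end_near. Qed.

(** Right-continuity of the paths passes to the expectation of the indicator by dominated
    convergence, along sequences approaching [s] from the right. *)
Lemma transition_prob_rcont (s : R) : 0 <= s -> p r @[r --> s^'+] --> p s.
Proof.
move=> s0; apply/cvg_at_rightP => u [us ucvg].
have u0 n : 0 <= u n by rewrite (le_trans s0) // ltW.
have mX t : 0 <= t -> measurable [set w | X t w = i] by exact: (measurable_state HX).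
have pE t : 0 <= t -> P i [set w | X t w = i] = (\int[P i]_w (b t w)%:E)%E.
  by move=> t0; rewrite integral_indic ?setIT //; exact: mX.
have [||||||_ _] := @dominated_convergence _ _ R (P i) setT _
  (fun n w => (b (u n) w)%:E) (fun w => (b s w)%:E) (fun=> 1%:E) => //.
- by move=> n; apply/measurable_EFinP; exact: measurable_at_state HX _ _ _.
- by apply/measurable_EFinP; exact: measurable_at_state HX _ _ _.
- apply: aeW => w _; apply: cvg_EFin; first exact: nearW.
  by have /cvg_at_rightP := indic_path_rcont w s s0; apply.
- exact: finite_measure_integrable_cst.
- by apply: aeW => w n _; rewrite lee_fin ger0_norm.
rewrite -pE // -(fineK (fin_num_measure (P i) _ (mX s s0))).
move=> /fine_cvgP[_]; apply: cvg_trans; apply: near_eq_cvg; near=> n => /=.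
by rewrite /transition_prob pE.
Unshelve. all: by end_near. Qed.

Definition riemann_occupation (t : R) (n : nat) (w : Omega) : R :=
  mesh t n * \sum_(j < n.+1) b (mesh t n *+ j.+1) w.

Lemma riemann_occupation_cvg (t : R) (w : Omega) : 0 < t ->
  riemann_occupation t n w @[n --> \oo] --> local_time X i t w.
Proof.
move=> t0; pose g s : R := \1_[set u | X u w = i] s.
apply: (right_sum_cvg t t0 g 1) => s.
  by move=> _; rewrite /g indicE; case: (_ \in _); rewrite ?ler01 ?lexx.
by move=> /andP[s0 _]; exact: (indic_path_rcont w s s0).
Qed.

Lemma riemann_occupation_bounds (t : R) (n : nat) (w : Omega) : 0 < t ->
  0 <= riemann_occupation t n w <= t.
Proof.
move=> t0; have h0 := mesh_gt0 t t0 n.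
apply/andP; split; first by rewrite mulr_ge0 // ?(ltW h0) // sumr_ge0.
rewrite -[leRHS](mesh_total t n) -mulr_natr; apply: ler_wpM2l; first exact: ltW.
by rewrite -[n.+1 in leRHS]card_ord -sumr_const ler_sum // => j _.
Qed.

Lemma measurable_riemann_occupation (t : R) (n : nat) : 0 < t ->
  measurable_fun setT (riemann_occupation t n).
Proof.
move=> t0; apply: measurable_funM => //; apply: measurable_sum => j.
by apply: (measurable_at_state P X HX); rewrite mulrn_wge0 // ltW // mesh_gt0.
Qed.

(** The Riemann sums converge path by path to the local time and never exceed [t], so
    [expR (kappa * t)] dominates the exponentials. *)
Lemma exp_moment_cvg (kappa t : R) : 0 < kappa -> 0 < t ->
  (renewal (fun j => p (mesh t n *+ j)) (expR (kappa * mesh t n) - 1) 0 n.+1)%:E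
    @[n --> \oo] -->
  'E_(P i)[fun w => expR (kappa * local_time X i t w)]%E.
Proof.
move=> k0 t0; have h0 n := mesh_gt0 t t0 n.
(* The renewal identity needs a pinned event to start from; this one has probability one, so its
   indicator can be removed from the limit at the end. *)
pose A := [set w | X 0 w = i].
have mA : measurable A by exact: (measurable_state HX).
have PA : P i A = 1%E by exact: (initial_state HX).
pose F n w := \1_A w * expR (kappa * riemann_occupation t n w).
have FE n : (renewal (fun j => p (mesh t n *+ j)) (expR (kappa * mesh t n) - 1)
    0 n.+1)%:E = (\int[P i]_w (F n w)%:E)%E.
  under eq_integral do rewrite /F /riemann_occupation -visit_prod_expR.
  rewrite (integral_visit_prod P X HX) ?PA ?mul1e //; last exact: (pinned0 P X HX i).
  - by rewrite subr_ge0 -expR0 ler_expR mulr_ge0 // ltW.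
  - exact: ltW.
have mF n : measurable_fun setT (F n).
  apply: measurable_funM; first exact/measurable_indicP.
  apply: measurableT_comp => //; apply: measurable_funM => //.
  exact: measurable_riemann_occupation.
have Lcvg w : expR (kappa * riemann_occupation t n w) @[n --> \oo] -->
    expR (kappa * local_time X i t w).
  apply: continuous_cvg; first exact: continuous_expR.
  by apply: cvgM; [exact: cvg_cst|exact: riemann_occupation_cvg].
have Fcvg w : F n w @[n --> \oo] --> \1_A w * expR (kappa * local_time X i t w).
  by apply: cvgM => //; exact: cvg_cst.
(* Measurability of the local time in [w] is inherited from the Riemann sums. *)
have mL : measurable_fun setT (fun w => expR (kappa * local_time X i t w)).
  apply: (@measurable_fun_cvg _ _ _ _
    (fun n w => expR (kappa * riemann_occupation t n w))) => //.
  move=> n; apply: measurableT_comp => //; apply: measurable_funM => //.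
  exact: measurable_riemann_occupation.
have [||||||_ _] := @dominated_convergence _ _ R (P i) setT _
  (fun n w => (F n w)%:E) (fun w => (\1_A w * expR (kappa * local_time X i t w))%:E)
  (fun=> (expR (kappa * t))%:E) => //.
- by move=> n; apply/measurable_EFinP.
- by apply/measurable_EFinP; apply: measurable_funM => //; exact/measurable_indicP.
- apply: aeW => w _; apply: cvg_EFin; first exact: nearW.
  exact: Fcvg.
- exact: finite_measure_integrable_cst.
- apply: aeW => w n _; rewrite lee_fin ger0_norm ?mulr_ge0 ?expR_ge0 //.
  have /andP[_ le_t] := riemann_occupation_bounds t n w t0.
  rewrite /F indicE; case: (_ \in _).
    by rewrite mul1r ler_expR ler_pM2l.
  by rewrite mul0r expR_ge0.
under eq_fun do rewrite -FE.
suff -> : 'E_(P i)[fun w => expR (kappa * local_time X i t w)]%E =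
  (\int[P i]_w (\1_A w * expR (kappa * local_time X i t w))%:E)%E by [].
rewrite unlock; apply: ae_eq_integral => //.
- exact/measurable_EFinP.
- by apply/measurable_EFinP; apply: measurable_funM => //; exact/measurable_indicP.
exists (~` A); split; first exact: measurableC.
  by apply: etrans (probability_setC (P i) mA) _; rewrite PA subee.
move=> w /= H Aw; apply: H => _.
by rewrite indicE mem_set // mul1r.
Qed.

End ExponentialMoment.

(** * The Laplace transform and the growth of the renewal sequence *)

Section LaplaceRenewal.
Context {R : realType} (f : R -> R).
Hypothesis f_bounds : forall s, 0 <= s -> 0 <= f s <= 1.
Hypothesis f_rcont : forall s, 0 <= s -> f r @[r --> s^'+] --> f s.
Local Notation mu := (@lebesgue_measure R).
Local Notation damped l := (fun s : R => expR (- l * s) * f s).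

Lemma f_nonneg (s : R) : 0 <= s -> 0 <= f s.
Proof. by move=> /f_bounds/andP[]. Qed.

Lemma damped_bounds (l s : R) : 0 < l -> 0 <= s -> 0 <= damped l s <= 1.
Proof.
move=> l0 s0; have /andP[f0 f1] := f_bounds s s0.
rewrite mulr_ge0 ?expR_ge0 //= mulr_ile1 ?expR_ge0 //.
by rewrite -expR0 ler_expR mulNr oppr_le0 mulr_ge0 // ltW.
Qed.

Lemma damped_rcont (l s : R) : 0 <= s -> damped l r @[r --> s^'+] --> damped l s.
Proof.
move=> s0; apply: cvgM; last exact: f_rcont.
apply: cvg_at_right_filter; apply: continuous_cvg; first exact: continuous_expR.
by apply: cvgM; [exact: cvg_cst|exact: cvg_id].
Qed.

Lemma itv0y_bigcup :
  `[(0 : R), +oo[%classic = \bigcup_n `[0%R, (n.+1%:R : R)[%classic.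
Proof.
apply/seteqP; split => s /=; rewrite in_itv /= ?andbT => s0.
  exists (Num.trunc s) => //=; rewrite in_itv /= s0 /=.
  by have /andP[] := trunc_itv s0.
by case: s0 => n _ /=; rewrite in_itv /= => /andP[].
Qed.

Lemma measurable_damped (l : R) : 0 < l -> measurable_fun `[(0 : R), +oo[ (damped l).
Proof.
move=> l0; rewrite itv0y_bigcup; apply/measurable_fun_bigcup => // n.
apply: measurable_right_continuous => // s /andP[s0 _].
exact: damped_rcont.
Qed.

Lemma emeasurable_damped (l : R) : 0 < l ->
  measurable_fun `[(0 : R), +oo[ (fun s => (damped l s)%:E).
Proof. by move=> l0; apply/measurable_EFinP; exact: measurable_damped. Qed.

Lemma itv0yP (s : R) : `[(0 : R), +oo[%classic s -> 0 <= s.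
Proof. by rewrite /= in_itv /= andbT. Qed.

Lemma damped_ge0 (l s : R) : 0 <= s -> (0 <= (damped l s)%:E)%E.
Proof.
by move=> s0; rewrite lee_fin mulr_ge0 ?expR_ge0 //; have /andP[] := f_bounds s s0.
Qed.

(** Since [f <= 1], [l] times the integrand is at most the exponential density of rate [l], whose
    total mass is [1]. This bound makes the set in [laplace_inv] nonempty. *)
Lemma laplace_le_inv (l : R) : 0 < l -> (laplace f l <= (l^-1)%:E)%E.
Proof.
move=> l0; rewrite -(@lee_pmul2l _ l%:E) // -?EFinM ?lte_fin //.
rewrite divff ?gt_eqF // /laplace -ge0_integralZl_EFin ?(ltW l0) //; first last.
- exact: emeasurable_damped.
- by move=> s /itv0yP; exact: damped_ge0.
rewrite -(integral_exponential_pdf l0).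
apply: (@le_trans _ _ (\int[mu]_(s in `[0%R, +oo[) (exponential_pdf l s)%:E)%E).
  apply: ge0_le_integral => //.
  - by move=> s /itv0yP s0; rewrite mule_ge0 ?damped_ge0 // lee_fin ltW.
  - by apply: measurable_funeM; exact: emeasurable_damped.
  - by apply/measurable_EFinP/measurable_funTS; exact: measurable_exponential_pdf.
  - move=> s /itv0yP s0; rewrite exponential_pdfE // -EFinM lee_fin ler_wpM2l ?(ltW l0) //.
    by rewrite ler_piMr ?expR_ge0 //; have /andP[] := f_bounds s s0.
apply: ge0_subset_integral => //.
- by apply/measurable_EFinP; exact: measurable_exponential_pdf.
- by move=> s _; rewrite lee_fin exponential_pdf_ge0 // ltW.
Qed.

(* Away from [0] the two integrands differ by a factor bounded away from [1],
   and since [f <= 1] the mass near [0] cannot account for all of [y]. *)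
Lemma laplace_gt (l l' y : R) : 0 < l -> l < l' -> 0 < y ->
  (y%:E <= laplace f l')%E -> (y%:E < laplace f l)%E.
Proof.
move=> l0 ll' y0 yL'; rewrite ltNge; apply/negP => Ly.
have l'0 : 0 < l' by exact: lt_trans ll'.
(* For [s >= delta] the ratio of the integrands is [expR ((l' - l) * s) >= 1 + eta]; on [[0, delta[]
   an error of [eta] per unit length suffices. If both transforms straddled [y], this would give
   [y <= delta], which any [delta < y] excludes. *)
pose delta := y / 2; pose eta := (l' - l) * delta.
have d0 : 0 < delta by rewrite divr_gt0.
have e0 : 0 < eta by rewrite mulr_gt0 // subr_gt0.
have : ((1 + eta)%:E * laplace f l' <= laplace f l + (eta * delta)%:E)%E.
  have -> : (eta * delta)%:E =
      (\int[mu]_(s in `[0%R, +oo[) (eta%:E * (\1_`[0%R, delta[ s)%:E))%E.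
    rewrite ge0_integralZl_EFin ?(ltW e0) //; last first.
      apply/measurable_EFinP; apply/measurable_funTS.
      by apply/measurable_indicP; exact: measurable_itv.
    rewrite integral_indic //.
    rewrite setIidl ?EFinM; last first.
      by move=> s /=; rewrite !in_itv /= andbT => /andP[].
    congr (_ * _)%E; apply: esym. apply: etrans (lebesgue_measure_itv _) _.
    by rewrite /= lte_fin d0 -EFinB subr0.
  have mind : measurable_fun `[(0 : R), +oo[ (fun s => (eta%:E * (\1_`[0%R, delta[ s)%:E)%E).
    apply: measurable_funeM; apply/measurable_EFinP; apply/measurable_funTS.
    by apply/measurable_indicP; exact: measurable_itv.
  rewrite /laplace -ge0_integralZl_EFin ?addr_ge0 ?(ltW e0) //; first last.
  - exact: emeasurable_damped.
  - by move=> s /itv0yP; exact: damped_ge0.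
  rewrite -ge0_integralD //; first last.
  - by move=> s _; rewrite mule_ge0 // lee_fin ltW.
  - exact: emeasurable_damped.
  - by move=> s /itv0yP; exact: damped_ge0.
  apply: ge0_le_integral => //.
  - by move=> s /itv0yP s0; rewrite mule_ge0 ?damped_ge0 // lee_fin addr_ge0 // ltW.
  - by apply: measurable_funeM; exact: emeasurable_damped.
  - by apply: emeasurable_funD => //; exact: emeasurable_damped.
  move=> s /itv0yP s0; rewrite -!EFinM -EFinD lee_fin.
  have /andP[f0 f1] := f_bounds s s0.
  have e'0 := expR_ge0 (- l' * s).
  have eE : expR (- l * s) = expR (- l' * s) * expR ((l' - l) * s).
    by rewrite -expRD; congr expR; ring.
  have key := expR_ge1Dx ((l' - l) * s).
  have ll0 : 0 <= l' - l by rewrite subr_ge0 ltW.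
  rewrite indicE; have [sd|sd] := ltP s delta.
    rewrite mem_set /=; last by rewrite in_itv /= s0.
    have /andP[g0 g1] := damped_bounds l' s l'0 s0.
    have le1 : expR (- l' * s) * f s <= expR (- l * s) * f s.
      by rewrite ler_wpM2r // ler_expR ler_wpM2r // lerN2 ltW.
    nra.
  rewrite memNset /=; last by rewrite in_itv /= s0 /= ltNge sd.
  rewrite mulr0 addr0 eE mulrA (mulrC (1 + eta)) -!mulrA ler_wpM2l //.
  rewrite ler_wpM2r //; apply: le_trans key.
  by rewrite lerD2l ler_wpM2l.
have Lfin : laplace f l \is a fin_num.
  rewrite ge0_fin_numE; first exact: le_lt_trans Ly (ltry _).
  by apply: integral_ge0 => s /itv0yP; exact: damped_ge0.
move=> H.
have {H} : ((1 + eta)%:E * y%:E <= y%:E + (eta * delta)%:E)%E.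
  apply: le_trans (le_trans H _); last exact: leeD.
  by rewrite lee_pmul2l // lte_fin addr_gt0.
rewrite -EFinM -EFinD lee_fin /delta.
nra.
Qed.

(** Monotone convergence along the intervals [[0, n + 1[]: were all truncated integrals at most [y],
    so would be their limit. *)
Lemma laplace_truncated_gt (l y : R) : 0 < l -> (y%:E < laplace f l)%E ->
  exists2 T, 0 < T & (y%:E < \int[mu]_(s in `[0%R, T[) (damped l s)%:E)%E.
Proof.
move=> l0 yL; apply: contrapT => noT.
have cvg : (\int[mu]_(s in `[0%R, n.+1%:R[) (damped l s)%:E)%E @[n --> \oo] -->
    laplace f l.
  rewrite /laplace itv0y_bigcup; apply: ge0_nondecreasing_set_cvg_integral => //.
  - apply/nondecreasing_seqP => n; apply/subsetPset => s /=.
    rewrite !in_itv /= => /andP[-> sn] /=; apply: lt_trans sn _.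
    by rewrite ltr_nat.
  - move=> n; apply: measurable_funS (emeasurable_damped l l0) => //.
    by move=> s /=; rewrite !in_itv /= => /andP[-> _].
  - by move=> n s /=; rewrite in_itv /= => /andP[s0 _]; exact: damped_ge0.
move: yL; rewrite ltNge; apply/negP; rewrite negbK.
apply: cvge_to_le cvg _; near=> n; rewrite leNgt; apply/negP => yn; apply: noT.
by exists n.+1%:R.
Unshelve. all: by end_near. Qed.

(** With [q = expR (l * h)], the weighted terms of the discrete bounds are samples of the Laplace
    integrand. *)
Lemma damped_mesh (l h : R) (j : nat) :
  f (h *+ j) * expR (l * h) ^- j = damped l (h *+ j).
Proof.
rewrite mulrC -expRM_natl -expRN; congr (expR _ * _).
by rewrite mulr_natl -mulrnAr mulNr.
Qed.

(** Multiply [1 - x <= expR (- x)] by [expR x]. *)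
Lemma expR_subr1_le (x : R) : expR x - 1 <= x * expR x.
Proof.
have := expR_ge1Dx (- x); rewrite expRN => h.
have e0 := expR_gt0 x.
have := ler_wpM2l (ltW e0) h; rewrite mulfV ?gt_eqF //; lra.
Qed.

Lemma renewal_mesh_le (l kappa : R) : 0 < l -> 0 < kappa ->
  (laplace f l < (kappa^-1)%:E)%E -> exists2 C, 0 < C & forall t, 0 < t ->
  \forall n \near \oo,
    renewal (fun j => f (mesh t n *+ j)) (expR (kappa * mesh t n) - 1) 0 n.+1
    <= C * expR (l * t).
Proof.
move=> l0 k0 Lk.
have L0 : (0 <= laplace f l)%E.
  by apply: integral_ge0 => s /itv0yP; exact: damped_ge0.
have Lfin : laplace f l \is a fin_num.
  by rewrite ge0_fin_numE //; exact: lt_trans Lk (ltry _).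
move: Lk L0; rewrite -(fineK Lfin) lte_fin lee_fin; set L := fine _ => Lk L0.
have kL1 : kappa * L < 1 by rewrite mulrC -ltr_pdivlMr // div1r.
(* The midpoint of [kappa * L] and [1] leaves room for the Riemann-sum error and for the factor
   [expR (kappa * h)]. It does not depend on [t]; only how large [n] must be does. *)
pose theta := (kappa * L + 1) / 2.
have th1 : theta < 1 by rewrite /theta; lra.
have kLth : kappa * L < theta by rewrite /theta; lra.
exists (1 - theta)^-1 => [|t t0]; first by rewrite invr_gt0 subr_gt0.
have h0 n := mesh_gt0 t t0 n.
have gb s : 0 <= s -> 0 <= damped l s <= 1 by move=> s0; exact: damped_bounds.
have gr s : 0 <= s < t -> damped l r @[r --> s^'+] --> damped l s.
  by move=> /andP[s0 _]; exact: damped_rcont.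
have [gint cvg] := integrable_right_sum_cvg t t0 (damped l) 1 gb gr.
have Ifin : (\int[mu]_(s in `[0%R, t[) (damped l s)%:E)%E \is a fin_num.
  exact: integrable_fin_num gint.
have : (\int[mu]_(s in `[0%R, t[) (damped l s)%:E <= L%:E)%E.
  rewrite /L fineK // /laplace; apply: ge0_subset_integral => //.
  - exact: emeasurable_damped.
  - by move=> s /itv0yP; exact: damped_ge0.
  - by move=> s /=; rewrite !in_itv /= => /andP[-> _].
move: cvg; rewrite -(fineK Ifin) lee_fin; set I := fine _ => /fine_cvgP[_ cvg] IL.
have : kappa * (expR (kappa * mesh t n) * (mesh t n *
    \sum_(j < n.+1) damped l (mesh t n *+ j.+1))) @[n --> \oo] -->
    kappa * (expR (kappa * 0) * I).
  apply: cvgM; first exact: cvg_cst.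
  apply: cvgM => //; apply: continuous_cvg; first exact: continuous_expR.
  by apply: cvgM; [exact: cvg_cst|exact: mesh_cvg0].
rewrite mulr0 expR0 mul1r => /cvgr_lt /(_ theta) cvgth.
have kIth : kappa * I < theta by apply: le_lt_trans kLth; rewrite ler_pM2l.
near=> n.
have : kappa * (expR (kappa * mesh t n) * (mesh t n *
    \sum_(j < n.+1) damped l (mesh t n *+ j.+1))) < theta.
  by near: n; exact: cvgth.
move=> thn.
have -> : expR (l * t) = expR (l * mesh t n) ^+ n.+1.
  by rewrite -expRM_natl mulr_natl -mulrnAr mesh_total.
rewrite [leRHS]mulrC; apply: (renewal_le _ _ _ _ _ _ n.+1) => //.
- by rewrite subr_ge0 -expR0 ler_expR mulr_ge0 // ltW.
- by move=> j; rewrite f_nonneg // mulrn_wge0 // ltW.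
- by rewrite -expR0 ler_expR mulr_ge0 // ltW.
apply: le_trans (ltW thn).
under eq_bigr do rewrite damped_mesh.
set G := \sum_(j < _) _.
have -> : kappa * (expR (kappa * mesh t n) * (mesh t n * G)) =
  kappa * mesh t n * expR (kappa * mesh t n) * G by ring.
apply: ler_wpM2r; last exact: expR_subr1_le.
rewrite sumr_ge0 // => j _.
by rewrite mulr_ge0 ?expR_ge0 // f_nonneg // mulrn_wge0 // ltW.
Unshelve. all: by end_near. Qed.

Lemma renewal_mesh_ge (l kappa : R) : 0 < l -> 0 < kappa ->
  ((kappa^-1)%:E < laplace f l)%E -> exists m T, 0 < m /\ 0 < T /\
  forall t, T < t -> \forall n \near \oo, m * expR (l * t) <=
    renewal (fun j => f (mesh t n *+ j)) (expR (kappa * mesh t n) - 1) 0 n.+1.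
Proof.
move=> l0 k0 /(laplace_truncated_gt _ _ l0) [T T0 kT].
exists (expR (- (l * T))), T; split; [exact: expR_gt0|split => // t Tt].
have t0 : 0 < t by exact: lt_trans Tt.
have h0 n := mesh_gt0 t t0 n.
(* The indicator of a half-open interval is right-continuous, so the Riemann sums of the truncated
   integrand over [[0, t[] converge to its integral over [[0, T[]. *)
pose g s := damped l s * \1_`[0%R, T[ s.
have gb s : 0 <= s -> 0 <= g s <= 1.
  move=> /(damped_bounds l s l0) /andP[g0 g1]; rewrite /g indicE.
  by case: (_ \in _); rewrite ?mulr1 ?mulr0 ?g0 ?g1 ?lexx ?ler01.
have gr s : 0 <= s < t -> g r @[r --> s^'+] --> g s.
  move=> /andP[s0 _]; apply: cvgM; first exact: damped_rcont.
  apply: cvg_near_cst; have [sT|Ts] := ltP s T; near=> r.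
    have sr : s < r by near: r; exact: nbhs_right_gt.
    have rT : r < T by near: r; exact: nbhs_right_lt.
    by rewrite !indicE !mem_set //= in_itv /= ?s0 ?sT ?rT ?(le_trans s0 (ltW sr)).
  have sr : s < r by near: r; exact: nbhs_right_gt.
  rewrite !indicE !memNset //= in_itv /= => /andP[_]; apply/negP; rewrite -leNgt //.
  exact: le_trans Ts (ltW sr).
have [gint cvg] := integrable_right_sum_cvg t t0 g 1 gb gr.
have gE : (\int[mu]_(s in `[0%R, t[) (g s)%:E =
    \int[mu]_(s in `[0%R, T[) (damped l s)%:E)%E.
  have -> : `[(0 : R), T[%classic = `[(0 : R), t[%classic `&` `[(0 : R), T[%classic.
    rewrite setIidr // => s /=; rewrite !in_itv /= => /andP[-> sT] /=.
    exact: lt_trans sT Tt.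
  rewrite integral_mkcondr epatch_indic.
  by apply: eq_integral => s _; rewrite /g EFinM.
move: cvg kT; rewrite -gE -(fineK (integrable_fin_num _ gint)) //.
set I := fine _; rewrite lte_fin => /fine_cvgP[_ /cvgr_gt cvgI] kI.
near=> n.
have sumI : kappa^-1 < mesh t n * \sum_(j < n.+1) g (mesh t n *+ j.+1).
  by near: n; exact: cvgI.
(* The last grid index with node at most [T]. Thus [q ^+ K <= expR (l * T)], which is why
   [m = expR (- (l * T))] works for every mesh. *)
pose K := Num.trunc (T / mesh t n).
have /andP[Klo Khi] := trunc_itv (divr_ge0 (ltW T0) (ltW (h0 n))).
move: Klo Khi; rewrite -/K ler_pdivlMr // ltr_pdivrMr // => Klo Khi.
have -> : expR (l * t) = expR (l * mesh t n) ^+ n.+1.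
  by rewrite -expRM_natl mulr_natl -mulrnAr mesh_total.
have f0 j : 0 <= f (mesh t n *+ j).
  by rewrite f_nonneg // mulrn_wge0 // ltW.
apply: (renewal_ge _ _ _ _ _ _ K) => //.
- by rewrite subr_ge0 -expR0 ler_expR mulr_ge0 // ltW.
- by rewrite -expR0 ler_expR mulr_ge0 // ltW.
- rewrite -expRM_natl -expRD -[leRHS]expR0 ler_expR addrC subr_le0.
  by rewrite mulrCA ler_pM2l.
have leKn : (K <= n.+1)%N.
  rewrite -(ler_nat R) -(ler_pM2r (h0 n)) (le_trans Klo) // mulr_natl mesh_total.
  exact: ltW.
pose G := \sum_(j < n.+1) g (mesh t n *+ j.+1).
have G1 : 1 < kappa * (mesh t n * G) by rewrite mulrC -ltr_pdivrMr // div1r.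
apply: le_trans (ltW G1) _; rewrite mulrA; apply: ler_pM.
- by rewrite mulr_ge0 // ltW.
- rewrite sumr_ge0 // => j _.
  by have /andP[] := gb (mesh t n *+ j.+1) (mulrn_wge0 _ (ltW (h0 n))).
- by rewrite lerBrDl expR_ge1Dx.
rewrite (big_ord_widen n.+1 (fun j => f (mesh t n *+ j.+1) *
  expR (l * mesh t n) ^- j.+1) leKn) big_mkcond /=.
apply: ler_sum => j _; rewrite damped_mesh /g indicE.
have dj : 0 <= damped l (mesh t n *+ j.+1).
  by rewrite mulr_ge0 ?expR_ge0.
case: ltnP => [_|leKj].
  by case: (_ \in _); rewrite ?mulr1 ?mulr0.
(* For [K <= j] the node of index [j.+1] lies beyond [T], so the truncated summand vanishes. *)
rewrite memNset ?mulr0 // /= in_itv /= => /andP[_]; apply/negP; rewrite -leNgt.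
apply: le_trans (ltW Khi) _; rewrite mulr_natl ler_pMn2l //.
Unshelve. all: by end_near. Qed.

End LaplaceRenewal.

(** * Exponential growth rates and the limit *)

(** After taking logarithms and dividing by [t], the constants contribute [ln C / t] and [ln m / t].
    Using rates [r + e / 2] and [r - e / 2] leaves [e / 2] to absorb them for large [t]. *)
Lemma growth_rate_cvg {R : realType} (v : R -> R) (r : R) : 0 <= r ->
  (forall t, 0 < t -> 1 <= v t) ->
  (forall l, r < l -> exists2 C, 0 < C & forall t, 0 < t -> v t <= C * expR (l * t)) ->
  (forall l, 0 < l -> l < r -> exists m T, 0 < m /\ forall t, T < t ->
    m * expR (l * t) <= v t) ->
  t^-1 * ln (v t) @[t --> +oo] --> r.
Proof.
move=> r0 v1 vle vge; apply/cvgrPdist_le => e e0.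
have e20 : 0 < e / 2 by rewrite divr_gt0.
have vgt0 t : 0 < t -> 0 < v t by move=> /v1; exact: lt_le_trans.
have hle : \forall t \near +oo, t^-1 * ln (v t) <= r + e.
  have [|C C0 vC] := vle (r + e / 2); first by rewrite ltrDl.
  near=> t.
  have t0 : 0 < t by near: t; exact: nbhs_pinfty_gt.
  have tC : ln C / (e / 2) <= t by near: t; apply: nbhs_pinfty_ge; rewrite num_real.
  rewrite ler_pdivrMl //.
  apply: (@le_trans _ _ (ln C + (r + e / 2) * t)).
    rewrite -[X in _ + X]expRK -lnM ?posrE ?expR_gt0 // ler_ln ?posrE ?vgt0 //.
      exact: vC.
    by rewrite mulr_gt0 ?expR_gt0.
  by move: tC; rewrite ler_pdivrMr //; lra.
have hge : \forall t \near +oo, r - e <= t^-1 * ln (v t).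
  (* Lower exponential bounds exist only for positive rates; otherwise [v >= 1] gives a nonnegative
     logarithm, which covers [r = 0]. *)
  have [re|re] := leP (r - e / 2) 0.
    near=> t.
    have t0 : 0 < t by near: t; exact: nbhs_pinfty_gt.
    apply: (@le_trans _ _ 0); first by lra.
    by rewrite mulr_ge0 ?invr_ge0 ?(ltW t0) // ln_ge0 // v1.
  have [|m [T [m0 vm]]] := vge (r - e / 2) re; first by rewrite ltrBlDr ltrDl.
  near=> t.
  have t0 : 0 < t by near: t; exact: nbhs_pinfty_gt.
  have tT : T < t by near: t; apply: nbhs_pinfty_gt; rewrite num_real.
  have tm : - ln m / (e / 2) <= t by near: t; apply: nbhs_pinfty_ge; rewrite num_real.
  rewrite ler_pdivlMl //.
  apply: (@le_trans _ _ (ln m + (r - e / 2) * t)).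
    by move: tm; rewrite ler_pdivrMr //; lra.
  rewrite -[X in _ + X]expRK -lnM ?posrE ?expR_gt0 // ler_ln ?posrE ?vgt0 //.
    exact: vm.
  by rewrite mulr_gt0 ?expR_gt0.
by near=> t; rewrite ler_distlC; apply/andP; split; near: t.
Unshelve. all: by end_near. Qed.

Theorem proposition3p9 (R : realType) (d : measure_display)
    (Omega : measurableType d) (S : countType)
    (P : S -> probability Omega R) (X : R -> Omega -> S)
    (HX : markov_chain P X) (i : S) (c alpha : R)
    (c_gt0 : 0 < c) (alpha_gt0 : 0 < alpha)
    (Hp : asymp_equiv (fun t => transition_prob P X t i i)
                      (fun t => c * t `^ (- alpha)))
    (kappa : R) (kappa_gt0 : 0 < kappa) :
  ((t^-1)%:E * lne 'E_(P i)[fun w => expR (kappa * local_time X i t w)])%E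
    @[t --> +oo] -->
  laplace_inv (fun t => transition_prob P X t i i) (kappa^-1).
Proof.
pose f t := transition_prob P X t i i; rewrite -/f.
pose u t := 'E_(P i)[fun w => expR (kappa * local_time X i t w)]%E.
have f01 s : 0 <= s -> 0 <= f s <= 1.
  by move=> s0; rewrite transition_prob_ge0 (transition_prob_le1 P X HX).
have f_rcont s : 0 <= s -> f r @[r --> s^'+] --> f s.
  exact: transition_prob_rcont.
have ucvg t (t0 : 0 < t) := exp_moment_cvg P X HX i kappa t kappa_gt0 t0.
have u_ge1 t : 0 < t -> (1 <= u t)%E.
  move=> t0; apply: cvge_to_ge (ucvg t t0) _; near=> n.
  rewrite lee_fin; apply: renewal_ge1 => [|j]; last exact: transition_prob_ge0.
  by rewrite subr_ge0 -expR0 ler_expR mulr_ge0 ?(ltW kappa_gt0) // ltW // mesh_gt0.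
pose A := [set l : R | 0 < l /\ (laplace f l < (kappa^-1)%:E)%E].
have u_le l : A l -> exists2 C, 0 < C & forall t, 0 < t ->
    (u t <= (C * expR (l * t))%:E)%E.
  move=> [l0 Ll].
  have [C C0 rC] := renewal_mesh_le f f01 f_rcont l kappa l0 kappa_gt0 Ll.
  exists C => // t t0; apply: cvge_to_le (ucvg t t0) _.
  by move: (rC t t0); apply: filterS => n; rewrite lee_fin.
(* The transform at [kappa + 1] is at most [1 / (kappa + 1) < 1 / kappa]. This makes the infimum a
   real number and every exponential moment finite. *)
have kA : A (kappa + 1).
  have k10 : 0 < kappa + 1 by rewrite addr_gt0.
  split => //; apply: le_lt_trans (laplace_le_inv f f01 f_rcont _ k10) _.
  by rewrite lte_fin ltf_pV2 ?posrE // ltrDl.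
have hasA : has_inf A.
  split; first by exists (kappa + 1).
  by exists 0 => l [/ltW].
have -> : laplace_inv f kappa^-1 = (inf A)%:E.
  by apply: ereal_inf_EFin; [exact: hasA.2|exact: hasA.1].
have ufin t : 0 < t -> u t \is a fin_num.
  move=> t0; have [C _ uC] := u_le _ kA.
  rewrite ge0_fin_numE; first exact: le_lt_trans (uC t t0) (ltry _).
  exact: le_trans (u_ge1 t t0).
have v1 t : 0 < t -> 1 <= fine (u t).
  by move=> t0; rewrite -lee_fin fineK ?u_ge1 ?ufin.
have : t^-1 * ln (fine (u t)) @[t --> +oo] --> inf A.
  apply: growth_rate_cvg => //.
  - by apply: lb_le_inf; [exists (kappa + 1)|move=> l [/ltW]].
  - move=> l /(inf_lt hasA.1) [l' Al' l'l].
    have [C C0 uC] := u_le l' Al'; exists C => // t t0.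
    rewrite -lee_fin fineK ?ufin //; apply: le_trans (uC t t0) _.
    by rewrite lee_fin ler_pM2l // ler_expR ler_pM2r // ltW.
  (* A rate below the infimum gives only the weak inequality [1 / kappa <= laplace f l']. Moving
     down from [l'] to [l] makes it strict by [laplace_gt], as the lower bound on the renewal
     sequence requires. *)
  - move=> l l0 lA; pose l' := (l + inf A) / 2.
    have l'A : l' < inf A by rewrite /l'; lra.
    have ll' : l < l' by rewrite /l'; lra.
    have Ll' : ((kappa^-1)%:E <= laplace f l')%E.
      rewrite leNgt; apply/negP => Ll'.
      have := ge_inf hasA.2 (conj (lt_trans l0 ll') Ll' : A l').
      by rewrite leNgt l'A.
    have kinv : 0 < kappa^-1 by rewrite invr_gt0.
    have Ll := laplace_gt f f01 f_rcont l l' _ l0 ll' kinv Ll'.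
    have [m [T [m0 [T0 rm]]]] := renewal_mesh_ge f f01 f_rcont l kappa l0 kappa_gt0 Ll.
    exists m, T; split => // t Tt; have t0 := lt_trans T0 Tt.
    rewrite -lee_fin fineK ?ufin //; apply: cvge_to_ge (ucvg t t0) _.
    by move: (rm t Tt); apply: filterS => n; rewrite lee_fin.
have lneE t : 0 < t -> ((t^-1)%:E * lne (u t))%E = (t^-1 * ln (fine (u t)))%:E.
  move=> t0; rewrite -{1}(fineK (ufin t t0)) lne_EFin //.
  exact: lt_le_trans (v1 t t0).
move=> vcvg; apply: cvg_EFin.
  by near=> t; rewrite lneE.
apply: cvg_trans vcvg; apply: near_eq_cvg; near=> t => /=.
by rewrite lneE.
Unshelve. all: by end_near. Qed.
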